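(* Let $\lambda>0$, let $\nu$ be a non-negative measure on $(0,\infty)$ with $\int_0^\infty (s\wedge 1)\,\nu(ds)<\infty$, let $f(x)=\int_0^\infty (1-e^{-xs})\,\nu(ds)$, and let $N^f(t)$, $t\ge 0$, be the generalized Poisson counting process associated with $(\lambda,\nu)$ (defined in the context), with state probabilities $p_k^f(t)=\Pr\{N^f(t)=k\}$. Then $$\frac{d}{dt}p_k^f(t)=-f(\lambda(I-B))\,p_k^f(t),\qquad t>0,\ k\ge 0,$$ where $B$ is the shift operator in $k$, $B\,p_k^f(t)=p_{k-1}^f(t)$, and $f(\lambda(I-B))$ is the operator defined in the context.
   Context: The generalized Poisson counting process $N^f(t)$, $t\ge0$, associated with $(\lambda,\nu)$ is a non-negative integer-valued process with $N^f(0)=0$, with independent and stationary increments, such that, writing $N^f[t,t+dt)$ for the increment over $[t,t+dt)$, as $dt\downarrow 0$, $$\Pr\{N^f[t,t+dt)=k\}=\begin{cases} dt\,\dfrac{\lambda^k}{k!}\displaystyle\int_0^\infty e^{-\lambda s}s^k\,\nu(ds)+o(dt), & k\ge 1,\\[2mm] 1-dt\displaystyle\int_0^\infty(1-e^{-\lambda s})\,\nu(ds)+o(dt), & k=0.\end{cases}$$ The operator $B$ acts on sequences indexed by $k$ by $B^m p_k=p_{k-m}$ for $0\le m\le k$, and $B^mp_k=0$ for $m>k$; $I$ is the identity. The operator $f(\lambda(I-B))$ is $$f(\lambda(I-B))\,p_k=\int_0^\infty\bigl(1-e^{-\lambda s(I-B)}\bigr)p_k\,\nu(ds),\qquad e^{-\lambda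 s(I-B)}p_k=e^{-\lambda s}\sum_{m=0}^\infty\frac{(\lambda sB)^m}{m!}\,p_k .$$ *)

(* Defs.v *)
From HB Require Import structures.
From mathcomp Require Import all_boot all_order all_algebra.
From mathcomp Require Import all_classical all_reals all_analysis.
Set Implicit Arguments.
Unset Strict Implicit.
Unset Printing Implicit Defensive.
Import Order.TTheory GRing.Theory Num.Theory.
Import numFieldNormedType.Exports.
Local Open Scope classical_set_scope.
Local Open Scope ring_scope.

(* nu lives on the Borel sets of R; only its restriction to (0, +oo) is ever
   used, so this represents an arbitrary measure on (0, +oo). *)

(* f(x) = int_0^oo (1 - e^(-x s)) nu(ds) *)
Definition bernstein (R : realType) (nu : {measure set R -> \bar R}) (x : R)
  : R :=
  \int[nu]_(s in `]0, +oo[) (1 - expR (- (x * s))).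

Definition jump_rate (R : realType) (nu : {measure set R -> \bar R})
    (lambda : R) (k : nat) : R :=
  lambda ^+ k / k`!%:R *
  \int[nu]_(s in `]0, +oo[) (expR (- (lambda * s)) * s ^+ k).

Definition shiftB (R : realType) (p : nat -> R) (k : nat) : R :=
  if k is j.+1 then p j else 0.

Lemma iter_shiftB (R : realType) (m : nat) (p : nat -> R) (k : nat) :
  iter m (@shiftB R) p k = if (m <= k)%N then p (k - m)%N else 0.
Proof.
elim: m k => [|m IHm] k; first by rewrite subn0.
by case: k => [|k] //=; rewrite IHm subSS.
Qed.

(* The operator e^(-lambda s (I - B)), with (lambda s B)^m p_k expanded as
   (lambda s)^m B^m p_k. *)
Definition exp_shiftB (R : realType) (lambda s : R) (p : nat -> R) (k : nat)
  : R :=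
  expR (- (lambda * s)) *
  limn (series (fun m => (lambda * s) ^+ m / m`!%:R * iter m (@shiftB R) p k)).

(* The operator f(lambda (I - B)); extended-real valued, so that an equation
   with a real number also says that the integral converges. *)
Definition bernstein_shiftB (R : realType) (nu : {measure set R -> \bar R})
    (lambda : R) (p : nat -> R) (k : nat) : \bar R :=
  (\int[nu]_(s in `]0%R, +oo[) (p k - exp_shiftB lambda s p k)%:E)%E.

Section process.
Context (d : measure_display) (T : measurableType d) (R : realType).
Context (P : probability T R).
(* Only the values at times t >= 0 matter. *)
Implicit Types N : R -> {RV P >-> nat}.

(* N(t) - N(s), the increment over [s, t); it takes values in int, as
   subtraction on nat is truncated. *)
Definition increment N (s t : R) (w : T) : int :=
  (N t w)%:Z - (N s w)%:Z.

(* Since A i may be the full set, the product rule for the whole family contains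
   the one for each subfamily. *)
Definition independent_increments N : Prop :=
  forall (n : nat) (tau : nat -> R) (A : nat -> set int),
    0 <= tau 0%N ->
    (forall i, (i < n)%N -> tau i <= tau i.+1) ->
    P (\bigcap_(i < n) (increment N (tau i) (tau i.+1) @^-1` A i)) =
    (\prod_(i < n) P (increment N (tau i) (tau i.+1) @^-1` A i))%E.

Definition stationary_increments N : Prop :=
  forall (s t h : R) (A : set int), 0 <= s -> 0 <= t -> 0 <= h ->
    P (increment N s (s + h) @^-1` A) = P (increment N t (t + h) @^-1` A).

Record is_gen_poisson (lambda : R) (nu : {measure set R -> \bar R}) N
  : Prop := IsGenPoisson {
  gen_poisson0 : {ae P, forall w, N 0 w = 0%N} ;
  gen_poisson_indep : independent_increments N ;
  gen_poisson_stat : stationary_increments N ;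
  gen_poisson_jump : forall (t : R) (k : nat), 0 <= t -> (1 <= k)%N ->
    (fun h : R => fine (P (increment N t (t + h) @^-1` [set k%:Z])))
      = (fun h : R => h * jump_rate nu lambda k) +o_ (0^'+) (fun h : R => h) ;
  gen_poisson_stay : forall t : R, 0 <= t ->
    (fun h : R => fine (P (increment N t (t + h) @^-1` [set 0%:Z])))
      = (fun h : R => 1 - h * bernstein nu lambda) +o_ (0^'+) (fun h : R => h)
}.

Definition state_prob N (k : nat) (t : R) : R :=
  fine (P (N t @^-1` [set k])).

End process.

(* Main.v *)
Require Import Defs.
From HB Require Import structures.
From mathcomp Require Import all_boot all_order all_algebra.
From mathcomp Require Import all_classical all_reals all_analysis.
From mathcomp Require Import measurable_realfun ring lra zify.
Import Order.TTheory GRing.Theory Num.Theory.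
Import numFieldNormedType.Exports.
Local Open Scope classical_set_scope.
Local Open Scope ring_scope.

(** Since [N 0 = 0] almost surely and increments are stationary, the increment
    over [[t, t + h]] has the law of [N h]; it is therefore almost surely
    nonnegative, although paths are not assumed to be monotone.  Independence
    then turns the state probabilities into a convolution semigroup,
    [p_k (t + h) = \sum_(j <= k) p_(k-j) t * p_j h]
    ([state_prob_convolution]).

    The infinitesimal description of the process says that each quotient
    [(p_j h - (j == 0)) / h] has a limit [a_j] as [h] tends to [0] from the
    right ([state_prob_rate]).  Only finitely many [j] enter the convolution,
    so one may pass to the limit termwise.  The derivative from the right at
    [t] is immediate; for the one from the left, the same identity is used at
    [t - h], after the observation that it also yields left continuity of every
    [p_k].  Hence [p_k' t = \sum_(j <= k) p_(k-j) t * a_j]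
    ([convolution_is_derive]).

    The operator [f(lambda (I - B))] is the same finite sum up to sign: on the
    coordinate [k] the exponential series of the shift stops at [m = k], and the
    coefficient of [p_(k-m)] in the integrand is
    [(m == 0) - e^(-x) x^m / m!] with [x = lambda s].  The elementary inequality
    [x^m / m! <= e^x - 1] for [m >= 1] bounds all these coefficients by
    [1 - e^(-x)], which is integrable because it is at most
    [(1 + lambda) min(s, 1)].  The integral may thus be taken term by term,
    giving [- a_m] for each [m] ([bernstein_shiftB_sum], [shift_rate0],
    [shift_rateS]). *)

(** * Differentiating a convolution semigroup of sequences *)

Lemma cvg_sumr (R : realType) (I T : Type) (F : set_system T) (FF : Filter F)
    (s : seq I) (f : I -> T -> R) (l : I -> R) :
  (forall i, f i x @[x --> F] --> l i) ->
  \sum_(i <- s) f i x @[x --> F] --> \sum_(i <- s) l i.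
Proof.
move=> fl; apply: cvg_big => //; exact: add_continuous.
Qed.

(** The Kronecker term is the convolution unit, the value of the semigroup at
    time 0: subtracting it gives the generator quotient once divided by [h]. *)
Lemma convolution_increment {R : realType} {p : nat -> R -> R} :
  (forall k (t h : R), 0 <= t -> 0 <= h ->
     p k (t + h) = \sum_(j < k.+1) p (k - j)%N t * p j h) ->
  forall k (t h : R), 0 <= t -> 0 <= h ->
  p k (t + h) - p k t = \sum_(j < k.+1) p (k - j)%N t * (p j h - (j == 0)%:R).
Proof.
move=> pD k t h t0 h0; rewrite pD//.
under [RHS]eq_bigr do rewrite mulrBr.
rewrite sumrB; congr (_ - _).
by rewrite big_ord_recl/= subn0 mulr1 big1 ?addr0// => i _; rewrite mulr0.
Qed.

(** The increment formula is based at [t - h], where the weights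
    [p (k - j) (t - h)] still depend on [h]; the uniform bound on [p] replaces
    any knowledge of their limits. *)
Lemma convolution_left_cvg {R : realType} {p : nat -> R -> R} :
  (forall k (t : R), 0 <= t -> `|p k t| <= 1) ->
  (forall k (t h : R), 0 <= t -> 0 <= h ->
     p k (t + h) = \sum_(j < k.+1) p (k - j)%N t * p j h) ->
  (forall j, p j h - (j == 0)%:R @[h --> 0^'+] --> 0) ->
  forall k (t : R), 0 < t -> p k (t - h) @[h --> 0^'+] --> p k t.
Proof.
move=> p1 pD p0 k t t0.
apply: (subr_cvg0 _ _).1; apply: norm_cvg0.
have dom : \sum_(j < k.+1) `|p j h - (j == 0)%:R| @[h --> 0^'+] --> (0 : R).
  rewrite [X in _ --> X](_ : 0 = \sum_(j < k.+1) `|0 : R|); last first.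
    by rewrite normr0 big1.
  by apply: cvg_sumr => j; exact: cvg_norm (p0 j).
apply: (squeeze_cvgr _ (cvg_cst 0) dom).
have h0 := nbhs_right_gt (0 : R).
have ht := nbhs_right_lt t0.
near=> h; rewrite normr_ge0/=.
have hp : 0 < h by near: h.
have htn : 0 <= t - h by rewrite subr_ge0 ltW//; near: h.
have := convolution_increment pD k _ _ htn (ltW hp).
rewrite subrK distrC => ->.
apply: le_trans (ler_norm_sum _ _ _) _; apply: ler_sum => j _.
by rewrite normrM ler_piMl// p1.
Unshelve. all: by end_near. Qed.

(** Both one-sided quotients are finite sums of products of convergent terms.
    On the left, the weights are taken at [t - h], whose convergence is
    [convolution_left_cvg]. *)
Lemma convolution_is_derive {R : realType} {p : nat -> R -> R} {a : nat -> R} :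
  (forall k (t : R), 0 <= t -> `|p k t| <= 1) ->
  (forall k (t h : R), 0 <= t -> 0 <= h ->
     p k (t + h) = \sum_(j < k.+1) p (k - j)%N t * p j h) ->
  (forall j, (p j h - (j == 0)%:R) / h @[h --> 0^'+] --> a j) ->
  forall k (t : R), 0 < t ->
  is_derive t 1 (p k) (\sum_(j < k.+1) p (k - j)%N t * a j).
Proof.
move=> p1 pD pa k t t0.
have h0 := nbhs_right_gt (0 : R).
have ht := nbhs_right_lt t0.
have p0 j : p j h - (j == 0)%:R @[h --> 0^'+] --> 0.
  (* p j h - (j == 0) is h times a quotient that converges to a j *)
  rewrite -[X in _ --> X](mulr0 (a j)).
  apply: (@cvg_trans _ ((p j h - (j == 0)%:R) / h * h @[h --> 0^'+])).
    apply: near_eq_cvg; near=> h.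
    by rewrite mulfVK// gt_eqF//; near: h.
  by apply: cvgM (pa j) _; apply: cvg_at_right_filter; exact: cvg_id.
have left := convolution_left_cvg p1 pD p0.
suff cvgD : h^-1 *: ((p k \o shift t) (h *: 1) - p k t) @[h --> 0^'] -->
    \sum_(j < k.+1) p (k - j)%N t * a j.
  by apply: DeriveDef; [apply/cvg_ex; eexists; exact: cvgD|exact: cvg_lim cvgD].
apply: (@cvg_at_right_left_dnbhs _ R^o).
- apply: (@cvg_trans _ (\sum_(j < k.+1) p (k - j)%N t *
      ((p j h - (j == 0)%:R) / h) @[h --> 0^'+])); last first.
    apply: cvg_sumr => j.
    by apply: cvgM => //; exact: cvg_cst.
  apply: near_eq_cvg; near=> h.
  have hp : 0 < h by near: h.
  rewrite /= /shift/= [h *: 1]mulr1 [h + t]addrC.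
  rewrite (convolution_increment pD) ?ltW//.
  rewrite scaler_sumr; apply: eq_bigr => j _.
  by rewrite [_ *: _]mulrC mulrA.
- apply/cvg_at_leftNP; rewrite oppr0.
  apply: (@cvg_trans _ (\sum_(j < k.+1) p (k - j)%N (t - h) *
      ((p j h - (j == 0)%:R) / h) @[h --> 0^'+])); last first.
    apply: cvg_sumr => j.
    by apply: cvgM => //; exact: left.
  apply: near_eq_cvg; near=> h.
  have hp : 0 < h by near: h.
  have htn : 0 <= t - h by rewrite subr_ge0 ltW//; near: h.
  have := convolution_increment pD k _ _ htn (ltW hp).
  rewrite subrK => E.
  rewrite /= /shift/= [- h *: 1]mulr1 [- h + t]addrC -[p k (t - h) - _]opprB E.
  rewrite invrN scaleNr scalerN opprK scaler_sumr.
  by apply: eq_bigr => j _; rewrite [_ *: _]mulrC mulrA.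
Unshelve. all: by end_near. Qed.

(** * The state probabilities form a convolution semigroup *)

(** The preimage is split over the countably many values of [N s]; each piece
    is an event about [N s] and [N t] separately, and every subset of [nat] is
    measurable. *)
Lemma increment_preimage_measurable (d : measure_display)
    (T : measurableType d) (R : realType) (P : probability T R)
    (N : R -> {RV P >-> nat}) (s t : R) (A : set int) :
  measurable (increment N s t @^-1` A).
Proof.
rewrite (_ : _ @^-1` _ = \bigcup_i (N s @^-1` [set i] `&`
    N t @^-1` [set j | A (j%:Z - i%:Z)])).
  apply: bigcup_measurable => i _; apply: measurableI;
    by rewrite -[X in measurable X]setTI; exact: measurable_funPT.
apply/seteqP; split => w /=; first by move=> Aw; exists (N s w).
by move=> [i _ [<-]].
Qed.

Lemma ae_iff_measure (d : measure_display) (T : measurableType d)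
    (R : realType) (mu : {measure set T -> \bar R}) (A B : set T) :
  measurable A -> measurable B -> {ae mu, forall w, A w <-> B w} ->
  mu A = mu B.
Proof.
move=> mA mB [Z [mZ Z0 AB]].
have le X Y : measurable X -> measurable Y ->
    (forall w, ~ Z w -> X w -> Y w) -> (mu X <= mu Y)%E.
  move=> mX mY XY; rewrite -[leRHS]adde0 -Z0.
  apply: (@le_trans _ _ (mu (Y `|` Z))); last exact: measureU2.
  rewrite le_measure ?inE//; first exact: measurableU.
  by move=> w Xw; case: (pselect (Z w)) => Zw; [right|left; exact: XY].
have {}AB w : ~ Z w -> (A w <-> B w).
  by move=> nZ; apply: contrapT => nAB; apply: nZ; exact: AB.
by apply/eqP; rewrite eq_le !le// => w /AB[].
Qed.

Lemma increment_from0 (d : measure_display)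
    (T : measurableType d) (R : realType) (P : probability T R)
    (N : R -> {RV P >-> nat}) (t : R) (A : set int) :
  {ae P, forall w, N 0 w = 0%N} ->
  P (increment N 0 t @^-1` A) = P (N t @^-1` [set k | A k%:Z]).
Proof.
move=> N0; apply: ae_iff_measure.
- exact: increment_preimage_measurable.
- by rewrite -[X in measurable X]setTI; exact: measurable_funPT.
- by apply: filterS N0 => w N0w; rewrite /= /increment N0w subr0.
Qed.

(** By stationarity the increment has the law of [N h - N 0], which is
    almost surely the natural number [N h]. *)
Lemma increment_ge0 {d : measure_display}
    {T : measurableType d} {R : realType} {P : probability T R}
    {N : R -> {RV P >-> nat}} {t h : R} :
  {ae P, forall w, N 0 w = 0%N} -> stationary_increments N ->
  0 <= t -> 0 <= h -> {ae P, forall w, 0 <= increment N t (t + h) w}.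
Proof.
move=> N0 Nst t0 h0.
exists (increment N t (t + h) @^-1` [set z | z < 0]); split.
- exact: increment_preimage_measurable.
- rewrite -(Nst 0)// add0r increment_from0//.
  by rewrite (_ : _ @^-1` _ = set0) ?measure0//; apply/seteqP; split.
- by move=> w /= /negP; rewrite -ltNge.
Qed.

(** Almost surely, [N (t + h) = k] splits according to the value [j] of the
    increment over [[t, t + h]]; nonnegativity of the increment and of [N t]
    restricts [j] to [0, ..., k]. *)
Lemma state_prob_convolution (d : measure_display)
    (T : measurableType d) (R : realType) (P : probability T R)
    (N : R -> {RV P >-> nat}) (k : nat) (t h : R) :
  {ae P, forall w, N 0 w = 0%N} ->
  independent_increments N -> stationary_increments N ->
  0 <= t -> 0 <= h ->
  state_prob N k (t + h) =
  \sum_(j < k.+1) state_prob N (k - j) t * state_prob N j h.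
Proof.
move=> N0 Nind Nst t0 h0.
pose E (j : 'I_k.+1) := increment N 0 t @^-1` [set (k - j)%N%:Z] `&`
  increment N t (t + h) @^-1` [set j%:Z].
have mE j : measurable (E j).
  by apply: measurableI; exact: increment_preimage_measurable.
have mN s i : measurable (N s @^-1` [set i]).
  by rewrite -[X in measurable X]setTI; exact: measurable_funPT.
have PE j : P (E j) =
    (P (N t @^-1` [set (k - j)%N]) * P (N h @^-1` [set j : nat]))%E.
  (* independence on the subdivision 0 <= t <= t + h *)
  have /= := Nind 2%N (fun i => if i is i'.+1 then if i' is 0 then t else t + h
                            else 0)
    (fun i => if i is 0 then [set (k - j)%N%:Z] else [set j%:Z]).
  rewrite bigcap_mkord !big_ord_recl !big_ord0/= setIT mule1 => ->//.
    rewrite increment_from0// -(Nst 0)// add0r increment_from0//.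
    by congr (P _ * P _)%E; apply: eq_set => w /=;
      apply/propext; split=> [[]|->].
  by move=> [|[|]]// _; rewrite lerDl.
rewrite /state_prob.
rewrite (@ae_iff_measure _ _ _ P _ (\big[setU/set0]_(j < k.+1) E j))//.
- rewrite measure_bigsetU_ord//.
    rewrite -sum_fine => [|j _]; last exact: fin_num_measure.
    apply: eq_bigr => j _; transitivity (fine (P (E j))) => //.
    by rewrite PE fineM// fin_num_measure.
  move=> i j _ _ [w [[_ Ei] [_ Ej]]].
  by apply/val_inj; move: Ei; rewrite /= Ej => -[].
- exact: bigsetU_measurable.
- have := increment_ge0 N0 Nst t0 h0.
  apply: filterS2 N0 => w N0w inc; rewrite -bigcup_mkord_ord/=.
  move: inc; rewrite /increment => inc; split => [/= Nk|].
    exists (k - N t w)%N; first by rewrite /=; lia.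
    by rewrite /E /= /increment N0w inordK; lia.
  move=> [j /= jk]; rewrite /E /= /increment N0w inordK// => -[].
  by lia.
Qed.

(** * The Bernstein function of the shift as a finite sum *)

(** The coefficient of [p (k - m)] in [(I - e^(-lambda s (I - B))) p k]: the
    identity minus a Poisson weight of parameter [lambda * s]. *)
Definition shift_weight {R : realType} (lambda : R) (m : nat) (s : R) : R :=
  (m == 0)%:R - expR (- (lambda * s)) * ((lambda * s) ^+ m / m`!%:R).

(** The exponential series of the shift is a finite sum, because [B^m p_k = 0]
    for [m > k]. *)
Lemma exp_shiftB_sum {R : realType} (lambda s : R) (p : nat -> R) (k : nat) :
  exp_shiftB lambda s p k = expR (- (lambda * s)) *
    \sum_(m < k.+1) (lambda * s) ^+ m / m`!%:R * p (k - m)%N.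
Proof.
congr (_ * _); apply: norm_lim_near_cst; near=> n.
have kn : (k.+1 <= n)%N by near: n; exact: nbhs_infty_ge.
rewrite /series/= (big_cat_nat _ kn)//=.
rewrite [X in _ + X]big_nat_cond [X in _ + X]big1 => [|m].
  rewrite addr0 big_mkord; apply: eq_bigr => m _.
  by rewrite iter_shiftB -ltnS ltn_ord.
by rewrite andbT => /andP[km _]; rewrite iter_shiftB leqNgt km mulr0.
Unshelve. all: by end_near. Qed.

Lemma sub_exp_shiftB {R : realType} (lambda s : R) (p : nat -> R) (k : nat) :
  p k - exp_shiftB lambda s p k =
  \sum_(m < k.+1) p (k - m)%N * shift_weight lambda m s.
Proof.
rewrite exp_shiftB_sum mulr_sumr.
under [RHS]eq_bigr do rewrite mulrBr.
rewrite sumrB; congr (_ - _).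
  by rewrite big_ord_recl/= subn0 mulr1 big1 ?addr0// => i _; rewrite mulr0.
by apply: eq_bigr => m _; rewrite mulrA mulrC.
Qed.

(** For [m >= 1] this is [x^m / m! <= e^x - 1] multiplied by [e^(-x)], with
    [x = lambda * s]. *)
Lemma shift_weight_le {R : realType} (lambda s : R) (m : nat) :
  0 <= lambda * s -> `|shift_weight lambda m s| <= 1 - expR (- (lambda * s)).
Proof.
rewrite /shift_weight; set x := lambda * s => x0.
case: m => [|m] /=.
  rewrite expr0 fact0 divr1 mulr1 ger0_norm// subr_ge0.
  by rewrite -expR0 ler_expR oppr_le0.
rewrite sub0r normrN ger0_norm; last first.
  by rewrite mulr_ge0 ?expR_ge0// divr_ge0// exprn_ge0.
have := expR_ge1Dxn m x0.
rewrite -lerBrDl => /(ler_wpM2l (expR_ge0 (- x)))/le_trans; apply.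
by rewrite mulrBr mulr1 -expRD addNr expR0.
Qed.

(** With [x = lambda * s], from [1 - e^(-x) <= x] when [s <= 1] and from
    [1 - e^(-x) <= 1] otherwise. *)
Lemma one_sub_expR_le_min {R : realType} (lambda s : R) :
  0 < lambda -> 0 < s ->
  1 - expR (- (lambda * s)) <= (1 + lambda) * Num.min s 1.
Proof.
move=> l0 s0; have := expR_ge0 (- (lambda * s)).
have := expR_ge1Dx (- (lambda * s)).
by case: (leP s 1) => s1; nra.
Qed.

Lemma shift_weight_integrable {R : realType} {lambda : R}
    {nu : {measure set R -> \bar R}} :
  0 < lambda ->
  (\int[nu]_(s in `]0%R, +oo[) (Num.min s 1)%:E < +oo)%E ->
  forall m, nu.-integrable `]0, +oo[ (EFin \o shift_weight lambda m).
Proof.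
move=> l0 numin m.
have mD : measurable (`]0, +oo[ : set R) by exact: measurable_itv.
have imin : nu.-integrable `]0, +oo[ (fun s : R => (Num.min s 1)%:E).
  apply/integrableP; split.
    by apply/measurable_EFinP/measurable_minr => //; exact: measurable_cst.
  under eq_integral => s.
    rewrite inE/= in_itv/= andbT => s0.
    rewrite ger0_norm; last by rewrite le_min ltW//= ler01.
    over.
  exact: numin.
apply: (le_integrable mD _ _ (integrableZl mD (1 + lambda) imin)).
- apply/measurable_EFinP/measurable_funB; first exact: measurable_cst.
  have mls : measurable_fun (`]0, +oo[ : set R) (fun s => lambda * s).
    by apply: measurable_funM => //; exact: measurable_cst.
  apply: measurable_funM.
    by apply: measurableT_comp => //; exact: measurableT_comp.
  apply: measurable_funM; last exact: measurable_cst.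
  exact: measurable_funX.
- move=> s /=; rewrite in_itv/= andbT => s0.
  rewrite lee_fin; apply: le_trans (shift_weight_le _ _ _ _) _.
    by rewrite mulr_ge0// ltW.
  apply: le_trans (ler_norm _).
  exact: one_sub_expR_le_min.
Qed.

(** The off-diagonal entries are the jump rates and the diagonal one is
    [- f(lambda)]: the generator coefficients of the process. *)
Definition shift_rate {R : realType} (nu : {measure set R -> \bar R})
    (lambda : R) (m : nat) : R :=
  - \int[nu]_(s in `]0, +oo[) shift_weight lambda m s.

Lemma shift_rate0 {R : realType} (nu : {measure set R -> \bar R}) (lambda : R) :
  shift_rate nu lambda 0 = - bernstein nu lambda.
Proof.
congr (- _); apply: eq_Rintegral => s _.
by rewrite /shift_weight expr0 fact0 divr1 mulr1.
Qed.

(** The integrand of the jump rate is a multiple of the weight, whose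
    integrability allows the constant to leave the integral. *)
Lemma shift_rateS {R : realType} (nu : {measure set R -> \bar R}) (lambda : R)
    (m : nat) :
  0 < lambda ->
  (\int[nu]_(s in `]0%R, +oo[) (Num.min s 1)%:E < +oo)%E ->
  shift_rate nu lambda m.+1 = jump_rate nu lambda m.+1.
Proof.
move=> l0 numin; rewrite /shift_rate /jump_rate.
set c : R := _ / _.
have c0 : c != 0.
  by rewrite mulf_neq0 ?expf_neq0 ?invr_neq0 ?gt_eqF// ltr0n fact_gt0.
rewrite (@eq_Rintegral _ _ _ _ _ (fun s => - c^-1 * shift_weight lambda m.+1 s)
  (fun s => expR (- (lambda * s)) * s ^+ m.+1)).
  rewrite RintegralZl//; last exact: shift_weight_integrable.
  by rewrite mulNr mulrN mulVKf.
move=> s _; rewrite /shift_weight sub0r mulrNN exprMn mulrCA.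
by congr (_ * _); rewrite mulrAC -/c mulKf.
Qed.

Lemma bernstein_shiftB_sum {R : realType} (nu : {measure set R -> \bar R})
    (lambda : R) (p : nat -> R) (k : nat) :
  0 < lambda ->
  (\int[nu]_(s in `]0%R, +oo[) (Num.min s 1)%:E < +oo)%E ->
  bernstein_shiftB nu lambda p k =
  (- \sum_(m < k.+1) p (k - m)%N * shift_rate nu lambda m)%:E.
Proof.
move=> l0 numin.
have mD : measurable (`]0, +oo[ : set R) by exact: measurable_itv.
have iw := shift_weight_integrable l0 numin.
rewrite /bernstein_shiftB.
under eq_integral do rewrite sub_exp_shiftB -sumEFin.
rewrite integral_sum// => [|m]; last first.
  exact: (integrableZl mD (p (k - m)%N) (iw m)).
rewrite -sumrN -sumEFin; apply: eq_bigr => m _.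
under eq_integral do rewrite EFinM.
rewrite (integralZl mD (iw m)).
rewrite /shift_rate mulrN opprK EFinM /Rintegral fineK//.
exact: integrable_fin_num (iw m).
Qed.

(** * Small-time behaviour and the governing equations *)

Lemma addo_right_quotient {R : realType} (f g : R -> R) :
  f = g +o_ (0^'+) (fun h : R => h) ->
  (f h - g h) / h @[h --> 0^'+] --> 0.
Proof.
move=> /eqaddoP fg; apply/cvgr0Pnorm_le => e e0.
have h0 := nbhs_right_gt (0 : R); have {}fg := fg _ e0.
near=> h; have hp : 0 < h by near: h.
rewrite normrM normfV ler_pdivrMr ?normr_gt0 ?gt_eqF//.
by near: h.
Unshelve. all: by end_near. Qed.

(** The infinitesimal probabilities are used at [t = 0], where increments are
    almost surely the values of [N]. *)
Lemma state_prob_rate {d : measure_display} {T : measurableType d}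
    {R : realType} {P : probability T R} {N : R -> {RV P >-> nat}}
    {lambda : R} {nu : {measure set R -> \bar R}} :
  0 < lambda ->
  (\int[nu]_(s in `]0%R, +oo[) (Num.min s 1)%:E < +oo)%E ->
  is_gen_poisson lambda nu N ->
  forall j, (state_prob N j h - (j == 0)%:R) / h @[h --> 0^'+] -->
    shift_rate nu lambda j.
Proof.
move=> l0 numin [N0 _ _ Njump Nstay] j.
have PE : (fun h => fine (P (increment N 0 (0 + h) @^-1` [set j%:Z]))) =
    state_prob N j.
  apply/funext => h; rewrite add0r increment_from0// /state_prob.
  congr (fine (P _)).
  by apply: eq_set => w /=; apply/propext; split=> [[]|->].
have h0 := nbhs_right_gt (0 : R).
have key (g : R -> R) :
    (forall h, g h = (j == 0)%:R + h * shift_rate nu lambda j) ->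
    state_prob N j = g +o_ (0^'+) (fun h : R => h) ->
    (state_prob N j h - (j == 0)%:R) / h @[h --> 0^'+] -->
    shift_rate nu lambda j.
  move=> gE /addo_right_quotient fg.
  rewrite -[X in _ --> X]add0r.
  apply: cvg_trans (cvgD fg (cvg_cst (shift_rate nu lambda j))).
  apply: near_eq_cvg; near=> h.
  have hn0 : h != 0 by rewrite gt_eqF//; near: h.
  by rewrite addrfctE gE; field.
case: j PE key => [|j] PE key.
  have := Nstay 0 (lexx 0); rewrite PE; apply: key => h.
  by rewrite shift_rate0 mulrN.
have := Njump 0 j.+1 (lexx 0) isT; rewrite PE; apply: key => h.
by rewrite shift_rateS// add0r.
Unshelve. all: by end_near. Qed.

Theorem mainTheorem4 (R : realType) (lambda : R)
    (nu : {measure set R -> \bar R})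
    (d : measure_display) (T : measurableType d) (P : probability T R)
    (N : R -> {RV P >-> nat}) :
  0 < lambda ->
  (\int[nu]_(s in `]0%R, +oo[) (Num.min s 1)%:E < +oo)%E ->
  is_gen_poisson lambda nu N ->
  forall (t : R) (k : nat), 0 < t ->
    derivable (state_prob N k) t 1 /\
    (derive1 (state_prob N k) t)%:E =
      (- bernstein_shiftB nu lambda (fun j => state_prob N j t) k)%E.
Proof.
move=> l0 numin NP t k t0.
have p1 j (s : R) : 0 <= s -> `|state_prob N j s| <= 1.
  have mN : measurable (N s @^-1` [set j]).
    by rewrite -[X in measurable X]setTI; exact: measurable_funPT.
  move=> _; rewrite ger0_norm ?fine_ge0// -lee_fin fineK ?fin_num_measure//.
  exact: probability_le1.
have pD j (s h : R) : 0 <= s -> 0 <= h -> state_prob N j (s + h) =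
    \sum_(i < j.+1) state_prob N (j - i) s * state_prob N i h.
  by case: NP => N0 Nind Nst _ _; exact: state_prob_convolution.
have dp := convolution_is_derive p1 pD (state_prob_rate l0 numin NP) k t t0.
split; first exact: ex_derive.
by rewrite derive1E derive_val bernstein_shiftB_sum// EFinN oppeK.
Qed.
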